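(* For an integer $\Delta\ge 49$, let $\eta(\Delta):=\lceil 4(\ln\Delta+\ln\ln\Delta+3)\rceil$. Let $G$ be a graph of maximum degree $\Delta\ge 49$. If the minimum degree of $G$ is at least $\eta(\Delta)/2$, then $$\chi_o(G)\le \eta(\Delta)\,\chi(G).$$ Moreover, this is tight up to a multiplicative constant for a family of graphs of increasing chromatic numbers: there exist an absolute constant $c>0$ and an infinite family of graphs $G$, with unbounded chromatic numbers, each of maximum degree $\Delta(G)\ge 49$ and of minimum degree at least $\eta(\Delta(G))/2$, such that $\chi_o(G)\ge c\,\eta(\Delta(G))\,\chi(G)$ for every $G$ in the family.
   Context: All graphs are finite, undirected and simple. $\chi(G)$ is the chromatic number. An odd colouring of a graph $G$ is a proper vertex-colouring $\sigma$ of $G$ such that for every non-isolated vertex $v$ there is a colour that appears an odd number of times on the (open) neighbourhood $N_G(v)$. The odd chromatic number $\chi_o(G)$ is the minimum integer $k$ such that $G$ has an odd colouring $\sigma\colon V(G)\to\{1,\dots,k\}$. *)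

(* Defs.v *)
From HB Require Import structures.
From mathcomp Require Import all_boot all_order all_algebra.
From mathcomp Require Import all_classical all_reals all_analysis.

Set Implicit Arguments.
Unset Strict Implicit.
Unset Printing Implicit Defensive.

Import Order.TTheory GRing.Theory Num.Theory.

Record sgraph := SGraph {
  vertex :> finType;
  adj : rel vertex;
  adj_sym : symmetric adj;
  adj_irr : irreflexive adj }.

Section Graph.
Variable G : sgraph.

Definition nbhd (v : G) : {set G} := [set u | adj v u].

Definition degree (v : G) : nat := #|nbhd v|.

Definition max_degree : nat := \max_(v : G) degree v.

(* Every degree is smaller than #|G|, so the default value #|G| only matters
   for the graph without vertices, whose minimum degree is then 0. *)
Definition min_degree : nat := \big[minn/#|G|]_(v : G) degree v.

Definition proper_colouring (k : nat) (s : {ffun G -> 'I_k}) : bool :=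
  [forall u, forall v, adj u v ==> (s u != s v)].

Definition odd_colouring (k : nat) (s : {ffun G -> 'I_k}) : bool :=
  proper_colouring s &&
  [forall v, (nbhd v != finset.set0) ==>
     [exists c, odd #|[set u in nbhd v | s u == c]|]].

Definition colourable (k : nat) : bool :=
  [exists s : {ffun G -> 'I_k}, proper_colouring s].

Definition odd_colourable (k : nat) : bool :=
  [exists s : {ffun G -> 'I_k}, odd_colouring s].

Lemma rainbow_odd_colouring :
  odd_colouring [ffun v : G => enum_rank v].
Proof.
apply/andP; split.
  apply/forallP=> u; apply/forallP=> v; apply/implyP=> uv; rewrite !ffunE.
  by apply/eqP=> /enum_rank_inj e; move: uv; rewrite e adj_irr.
apply/forallP=> v; apply/implyP=> /set0Pn[w vw].
apply/existsP; exists (enum_rank w).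
rewrite (_ : [set u in nbhd v | _] = [set w]%SET) ?cards1 //.
apply/setP=> u; rewrite !inE ffunE (inj_eq enum_rank_inj).
by case: eqP => [->|_]; rewrite ?andbF // andbT; move: vw; rewrite inE.
Qed.

Lemma ex_odd_colourable : exists k, odd_colourable k.
Proof.
by exists #|G|; apply/existsP; eexists; exact: rainbow_odd_colouring.
Qed.

Lemma ex_colourable : exists k, colourable k.
Proof.
exists #|G|; apply/existsP; eexists.
by have /andP[] := rainbow_odd_colouring; eauto.
Qed.

Definition chromatic_number : nat := ex_minn ex_colourable.

Definition odd_chromatic_number : nat := ex_minn ex_odd_colourable.

End Graph.

Local Open Scope ring_scope.

Definition eta (R : realType) (D : nat) : int :=
  Num.ceil (4 * (ln (D%:R : R) + ln (ln (D%:R : R)) + 3)).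

(* Main.v *)
Require Import Defs.
From mathcomp Require Import all_boot all_order all_algebra.
From mathcomp Require Import all_classical all_reals all_analysis.
From mathcomp Require Import zify ring lra.
(* Finite sets come last, so that setP, set0, setUC, ... are theirs and not
   those of classical sets. *)
From mathcomp Require Import fintype finset.
Set Implicit Arguments.
Unset Strict Implicit.
Unset Printing Implicit Defensive.
Import Order.TTheory GRing.Theory Num.Theory.

(** Upper bound.  Fix an optimal proper colouring tau of G, put q = eta(Delta),
    choose g : G -> {1..q} uniformly at random and colour v by the pair
    (tau v, g v).  Whatever g is, this is proper and uses at most q * chi(G)
    colours, so only the bad events -- every colour appears an even number of
    times around v -- have to be avoided.

    For each v fix a set S_v of d = ceil(q/2) neighbours, which the hypothesis
    on the minimum degree provides.  Conditionally on all values of g outside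
    S_v, the event for v prescribes the parity of each colour on S_v.  Read the
    vertices of S_v one by one: each of them flips one parity, and in the end
    all the required flips must have been made.  A flip that repairs a wrong
    parity has at most k choices out of q when k parities are wrong; counting
    on this basis gives the recursion [pairings], hence a conditional
    probability p with p^2 <= d!/q^d ([card_odd_colours], [pairings_sqr]).

    As this bound is conditional, the event for v interacts only with the
    events for those u whose neighbourhood meets S_v.  There are at most
    d * Delta of them, and not Delta^2, because S_v is small.  The lopsided
    local lemma, in the counting form [local_lemma], thus needs only
    4 * p * d * Delta <= 1.  The value of eta is such that
    exp(d) >= 256 * Delta^2, which leaves the elementary inequality
    [factorial_bound].

    Lower bound.  Take the complete r-partite graph with parts of 128 r
    vertices, and for every part P and every A included in P with |A| <= r
    add a vertex adjacent to exactly P minus A.  If a colouring uses at most r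
    colours on P, let A consist of one vertex from each colour class of odd
    size in P: around the vertex of (P, A) all colours are then even.  Hence an
    odd colouring uses more than r colours on each part, and the parts have
    disjoint palettes, so that chi_o >= r^2, whereas chi = r.  Since A is
    restricted to a fraction 1/128 of its part, there are at most 2^(9r) sets A
    per part; this keeps ln Delta of order r with a constant small enough for
    eta <= 128 r, so the minimum degree condition holds and
    chi_o >= eta * chi / 128. *)

(** * A lopsided local lemma *)

Section LocalLemma.
(** The elements of T are equally likely outcomes, so that probabilities are
    quotients of cardinals; a / b bounds the probability of a bad event
    conditionally on the absence of any bad events outside its set [dep].  This
    dependency is directed: i in dep j need not imply j in dep i. *)
Variables (I T : finType) (bad : I -> {set T}) (dep : I -> {set I}).
Variables (a b D : nat).

Definition avoiding (U : {set I}) : {set T} :=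
  [set x | [forall i in U, x \notin bad i]].

Hypothesis card_dep : forall i, #|dep i| <= D.
Hypothesis dep_small : 4 * a * D <= b.
Hypothesis rare_small : 2 * a < b.
Hypothesis rare : forall i (U : {set I}), [disjoint U & dep i] ->
  b * #|bad i :&: avoiding U| <= a * #|avoiding U|.

Lemma avoidingS (U W : {set I}) : U \subset W -> avoiding W \subset avoiding U.
Proof.
move=> UW; apply/subsetP => x; rewrite !inE => /forall_inP xW.
by apply/forall_inP => i /(subsetP UW)/xW.
Qed.

Lemma leq_card_avoiding (U W : {set I}) :
  #|avoiding U| <=
    #|avoiding (U :|: W)| + \sum_(i in W) #|bad i :&: avoiding U|.
Proof.
have cup : avoiding U \subset
    avoiding (U :|: W) :|: \bigcup_(i in W) (bad i :&: avoiding U).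
  apply/subsetP => x xU; rewrite inE.
  case: (boolP [exists i in W, x \in bad i]) => [/exists_inP[i iW xi]|].
    by apply/orP; right; apply/bigcupP; exists i; rewrite // inE xi.
  rewrite negb_exists_in => /forall_inP xW; apply/orP; left.
  rewrite inE; apply/forall_inP => i; rewrite inE => /orP[iU|/xW//].
  by move: xU; rewrite inE => /forall_inP; apply.
apply: leq_trans (subset_leq_card cup) _.
apply: leq_trans (leq_card_setU _ _) _; rewrite leq_add2l.
elim/big_rec2: _ => [|i m X _ le]; first by rewrite cards0.
by apply: leq_trans (leq_card_setU _ _) _; rewrite leq_add2l.
Qed.

(** Avoiding arbitrary other bad events at most doubles the bound on the
    conditional probability of bad i.  By induction each of the at most D events
    of U that i depends on occurs in a proportion of at most 2a/b of
    avoiding U', hence altogether in at most one half since 4aD <= b.  So at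
    least half of avoiding U' is left in avoiding U, and the bound a/b that
    holds relative to avoiding U' is at most doubled. *)
Lemma rare_cond i (U : {set I}) :
  b * #|bad i :&: avoiding U| <= 2 * a * #|avoiding U|.
Proof.
have [n] := ubnP #|U|; elim: n => // n IH in i U * => /ltnSE cardU.
set W := U :&: dep i; set U' := U :\: dep i.
have far : [disjoint U' & dep i].
  by rewrite -setI_eq0 /U' setDE -setIA (setIC (~: _)) setICr setI0.
have -> : U = U' :|: W by rewrite setUC setID.
have cardW : #|W| <= D.
  exact: leq_trans (subset_leq_card (subsetIr _ _)) (card_dep i).
have half : #|avoiding U'| <= 2 * #|avoiding (U' :|: W)|.
  have := leq_card_avoiding U' W.
  have : b * \sum_(j in W) #|bad j :&: avoiding U'|
         <= D * (2 * a * #|avoiding U'|).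
    apply: leq_trans (leq_mul cardW (leqnn _)).
    rewrite big_distrr -sum_nat_const; apply: leq_sum => j jW; apply: IH.
    apply: leq_trans cardU; apply: proper_card.
    apply/properP; split; first exact: subsetDl.
    by move: jW; rewrite inE => /andP[jU jd]; exists j; rewrite // inE jd.
  by move: dep_small rare_small; set x := (\sum_(j in W) _); nia.
have sub : #|bad i :&: avoiding (U' :|: W)| <= #|bad i :&: avoiding U'|.
  by apply/subset_leq_card/setIS/avoidingS/subsetUl.
have := rare far.
by move: half sub; nia.
Qed.

Lemma local_lemma : 0 < #|T| -> exists x, forall i, x \notin bad i.
Proof.
move=> T_gt0; suff pos (U : {set I}) : 0 < #|avoiding U|.
  have /card_gt0P[x] := pos setT; rewrite inE => /forall_inP xT.
  by exists x => i; apply: xT; rewrite inE.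
have [n] := ubnP #|U|; elim: n => // n IH in U * => /ltnSE cardU.
have [->|[i iU]] := set_0Vmem U.
  suff -> : avoiding set0 = setT by rewrite cardsT.
  by apply/setP => x; rewrite !inE; apply/forall_inP => i; rewrite inE.
have posU : 0 < #|avoiding (U :\ i)|.
  by apply: IH; move: cardU; rewrite (cardsD1 i) iU.
have := leq_card_avoiding (U :\ i) [set i].
rewrite big_set1 (setUC _ [set i]) setD1K //.
by have := rare_cond i (U :\ i); move: rare_small posU; nia.
Qed.

End LocalLemma.

(** * Conditioning on the values outside a set *)

Section Fibres.
Variables (V C : finType).
Implicit Types (S : {set V}) (f g : {ffun V -> C}).

Definition fibre S f : {set {ffun V -> C}} :=
  [set g : {ffun V -> C} | [forall u, (u \notin S) ==> (g u == f u)]].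

Lemma fibreP S f g :
  reflect (forall u, u \notin S -> g u = f u) (g \in fibre S f).
Proof.
by rewrite inE; apply: (iffP forallP) => h u; [move=> uS; apply/eqP|apply/implyP=> uS];
  [exact: (implyP (h u))|rewrite h].
Qed.

Lemma card_fibre S f : #|fibre S f| = #|C| ^ #|S|.
Proof.
pose F u : pred C := if u \in S then predT else pred1 (f u).
have -> : #|fibre S f| = #|family F|.
  apply: eq_card => g; apply/fibreP/familyP => h u.
    by rewrite /F; case: ifPn => [//|/h ->]; rewrite !inE.
  by move=> uS; have := h u; rewrite /F (negbTE uS) inE => /eqP.
rewrite card_family foldrE big_map big_enum /=.
rewrite (bigID (mem S)) /= [X in _ * X]big1 ?muln1 => [|u uS]; last first.
  by rewrite /F (negbTE uS) card1.
rewrite -prod_nat_const; apply: eq_bigr => u uS.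
by rewrite /F uS.
Qed.

(** If an event has conditional probability at most M / |C|^|S| whatever the
    values outside S are, the same bound holds conditionally on any event that
    is decided outside S.  This is a double count of the pairs (f, g) that lie
    in a common fibre, with f in B and g in both A and B. *)
Lemma leq_card_fibre S (A B : {set {ffun V -> C}}) M :
    (forall f g, g \in fibre S f -> f \in B -> g \in B) ->
    (forall f, #|A :&: fibre S f| <= M) ->
  #|C| ^ #|S| * #|A :&: B| <= M * #|B|.
Proof.
move=> Bfib leM.
have fibreC f g : (g \in fibre S f) = (f \in fibre S g).
  by apply/fibreP/fibreP => h u /h.
rewrite mulnC -sum_nat_const.
have -> : \sum_(g in A :&: B) #|C| ^ #|S|
          = \sum_(g in A :&: B) \sum_(f in fibre S g) 1.
  by apply: eq_bigr => g _; rewrite sum1_card card_fibre.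
rewrite (exchange_big_dep (mem B)) /= => [|g f]; last first.
  by rewrite inE => /andP[_ gB] /Bfib; apply.
rewrite mulnC -sum_nat_const; apply: leq_sum => f _.
apply: leq_trans (leM f); rewrite sum1_card; apply: subset_leq_card.
apply/subsetP => g /andP[/setIP[gA _] gf].
by apply/setIP; split; rewrite // fibreC.
Qed.

End Fibres.

(** * The number of ways to correct parities *)

(** The number of partitions of r items and k marks into pairs that use every
    mark in a pair with an item, where each pair of two items gets one of q
    labels.  The recursion handles the last item: it is paired with a mark, or
    it gets a label and becomes a mark for the remaining items. *)
Fixpoint pairings (q r k : nat) : nat :=
  if r is r'.+1 then k * pairings q r' k.-1 + q * pairings q r' k.+1
  else (k == 0).

(** The recursion from the point of view of a mark rather than of an item: the
    last mark goes with any of the r + 1 items. *)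
Lemma pairingsSS q r k : pairings q r.+1 k.+1 = r.+1 * pairings q r k.
Proof.
elim: r k => [|r IH] k; first by case: k => [|k] /=; rewrite ?muln0 ?muln1 ?mul1n.
have := IH k.+1; have IHk := IH k.-1.
have IHm : k * pairings q r.+1 k = r.+1 * (k * pairings q r k.-1).
  by case: k IHk => [|k] /= IHk; rewrite ?muln0 // IHk mulnCA.
move=> IHp; rewrite [LHS]/= -/(pairings q r.+1 k) -/(pairings q r.+1 k.+2) IHp.
have e : pairings q r.+1 k = k * pairings q r k.-1 + q * pairings q r k.+1 by [].
by rewrite mulSn IHm (mulnCA q) -addnA -mulnDr -e -mulSn.
Qed.

(** By [pairingsSS] the last mark contributes a factor r, and if there is no
    mark, the last two items contribute q (r - 1).  The bound shrinks by q r at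
    the last item and by q r * q (r - 1) at the last two, which dominates the
    squares of these factors as long as r <= q. *)
Lemma pairings_sqr q r k : r <= q -> pairings q r k ^ 2 <= q ^ r * r`!.
Proof.
have [n] := ubnP r; elim: n => // n IH in r k * => /ltnSE rn rq.
case: k r rn rq => [|k] [|r] // rn rq.
  rewrite [pairings _ _ _]/= mul0n add0n; case: r rn rq => [|r] rn rq.
    by rewrite /= muln0.
  have le := IH r 0 ltac:(lia) ltac:(lia).
  rewrite pairingsSS !expnMn.
  have -> : q ^ r.+2 * r.+2`! = q ^ 2 * (r.+2 * r.+1 * (q ^ r * r`!)).
    by rewrite !factS !expnS; ring.
  by rewrite leq_mul2l leq_mul ?orbT // -mulnn leq_mul.
have le := IH r k ltac:(lia) ltac:(lia).
rewrite pairingsSS expnMn.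
have -> : q ^ r.+1 * r.+1`! = q * r.+1 * (q ^ r * r`!).
  by rewrite factS expnS; ring.
by rewrite leq_mul // -mulnn leq_mul.
Qed.

(** * The parities of colours in a neighbourhood *)

Section Parity.
Variables (V C L : finType) (col : V -> C -> L).
Hypothesis col_inj : forall v, injective (col v).
Implicit Types (S N : {set V}) (f g : {ffun V -> C}) (t : {set L}).

(** In the application [col v c] is (tau v, c): a vertex can only get the
    colours of its own tau-class, but a fresh choice of c always changes the
    colour, whence the injectivity of col v. *)
Definition odd_colours N g : {set L} :=
  [set c | odd #|[set u in N | col u (g u) == c]|].

Lemma odd_coloursD1 S g s : s \in S ->
  odd_colours (S :\ s) g =
    let c := col s (g s) in
    if c \in odd_colours S g then odd_colours S g :\ c
    else c |: odd_colours S g.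
Proof.
move=> sS /=; set c := col s (g s).
have split c' : (c' \in odd_colours S g)
    = (c' == c) (+) (c' \in odd_colours (S :\ s) g).
  rewrite !inE (cardsD1 s) inE sS /= oddD -/c eq_sym oddb.
  by congr addb; congr odd; apply: eq_card => u; rewrite !inE andbA.
case: ifPn => cS; apply/setP => c'; rewrite [RHS]inE in_set1 split;
  case: eqP => //= ->; move: cS; rewrite split eqxx addTb ?negbK //.
by move/negbTE.
Qed.

(** The vertices of S are treated one at a time.  The colour of the vertex s is
    either one of the colours of t, of which there are at most #|t|, and then one
    parity less remains to be corrected, or any other one of the #|C| colours,
    and then one more does.  This is the recursion of [pairings]. *)
Lemma card_odd_colours S f t :
  #|[set g in fibre S f | odd_colours S g == t]| <= pairings #|C| #|S| #|t|.
Proof.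
move: {2}#|S| (erefl #|S|) => r; elim: r S f t => [|r IH] S f t.
  move/eqP; rewrite cards_eq0 => /eqP ->; rewrite cards0 /= cards_eq0.
  case: (altP (t =P set0)) => [_|t0].
    rewrite -[leqRHS](cards1 f); apply/subset_leq_card/subsetP => g.
    rewrite inE => /andP[/fibreP gf _]; rewrite inE; apply/eqP/ffunP => u.
    by apply: gf; rewrite inE.
  rewrite leqn0 cards_eq0; apply/eqP/setP => g; rewrite !inE.
  apply/negbTE; rewrite negb_and orbC; apply/orP; left.
  apply: contra t0 => /eqP <-; apply/eqP/setP => c; rewrite !inE.
  by rewrite (_ : [set _ in _ | _] = set0) ?cards0 //; apply/setP => u; rewrite !inE.
move=> cardS; have /card_gt0P[s sS] : 0 < #|S| by rewrite cardS.
have cardS' : #|S :\ s| = r by move: cardS; rewrite (cardsD1 s) sS => -[].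
pose flip c := let c' := col s c in if c' \in t then t :\ c' else c' |: t.
pose upd c : {ffun V -> C} := [ffun u => if u == s then c else f u].
rewrite -sum1_card.
rewrite (partition_big (fun g : {ffun V -> C} => g s) predT) //=.
have step c : \sum_(g in [set g in fibre S f | odd_colours S g == t] | g s == c) 1
    <= pairings #|C| r #|flip c|.
  have := IH (S :\ s) (upd c) (flip c) cardS'; rewrite cardS'.
  apply: leq_trans; rewrite sum1_card; apply/subset_leq_card/subsetP => g.
  move=> /andP[]; rewrite !inE -/(fibre S f) => /andP[gf /eqP gt] /eqP gs.
  apply/andP; split.
    apply/forallP => u; apply/implyP; rewrite !inE negb_and negbK ffunE.
    case: eqP => [-> _|/= _ uS]; first by rewrite gs.
    by move/forallP: gf => /(_ u) /implyP; apply.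
  by rewrite odd_coloursD1 //= gt gs.
apply: leq_trans (_ : \sum_c pairings #|C| r #|flip c| <= _).
  by apply: leq_sum => c _; apply: step.
rewrite (bigID (fun c => col s c \in t)) /= cardS /=; apply: leq_add.
  have -> : \sum_(c | col s c \in t) pairings #|C| r #|flip c|
          = #|[set c | col s c \in t]| * pairings #|C| r #|t|.-1.
    rewrite -sum_nat_const; apply: eq_big => [c|c ct]; first by rewrite inE.
    by rewrite /flip ct [in RHS](cardsD1 (col s c)) ct.
  rewrite leq_mul2r; apply/orP; right.
  rewrite -(card_imset _ (@col_inj s)).
  by apply/subset_leq_card/subsetP => _ /imsetP[c + ->]; rewrite inE.
apply: leq_trans (_ : \sum_(c | col s c \notin t) pairings #|C| r #|t|.+1 <= _).
  by apply: leq_sum => c ct; rewrite /flip (negbTE ct) cardsU1 ct.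
rewrite sum_nat_const leq_mul2r; apply/orP; right; exact: max_card.
Qed.

(** When g is known outside S, all parities on N are even if and only if the
    parities on S are those of the known part of N. *)
Lemma card_even_fibre N S f : S \subset N ->
  exists k, #|[set g | odd_colours N g == set0] :&: fibre S f|
              <= pairings #|C| #|S| k.
Proof.
move=> SN; exists #|odd_colours (N :\: S) f|.
apply: leq_trans (card_odd_colours S f _).
apply/subset_leq_card/subsetP => g; rewrite in_setI in_set => /andP[/eqP even gf].
rewrite in_set gf; apply/eqP/setP => c; rewrite !inE.
have -> : [set u in N :\: S | col u (f u) == c]
        = [set u in N :\: S | col u (g u) == c].
  apply/setP => u; rewrite !inE; case: (boolP (u \in S)) => //= uS.
  by move/fibreP: gf => ->.
have /setP /(_ c) := even; rewrite !inE.
rewrite -(cardsID S) oddD => /negbT; rewrite negb_add => /eqP.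
set a := [set _ in _ | _] :&: S; set b := [set _ in _ | _] :\: S.
have -> : a = [set u in S | col u (g u) == c].
  apply/setP => u; rewrite !inE andbC andbA; congr (_ && _).
  by case: (boolP (u \in S)) => //= /(subsetP SN) ->.
by have -> : b = [set u in N :\: S | col u (g u) == c];
  first by apply/setP => u; rewrite !inE andbA.
Qed.

End Parity.

(** * Odd colourings of graphs with large minimum degree *)

Lemma min_degree_leq (G : sgraph) (v : G) : min_degree G <= degree v.
Proof.
rewrite /min_degree; have := mem_index_enum v.
elim: (index_enum G) => // u s IH; rewrite inE big_cons.
by case/predU1P => [->|/IH]; [exact: geq_minl|exact/leq_trans/geq_minr].
Qed.

Lemma leq_min_degree (G : sgraph) d :
  d <= #|G| -> (forall v : G, d <= degree v) -> d <= min_degree G.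
Proof.
move=> dG dv; rewrite /min_degree; elim/big_ind: _ => // a b.
by rewrite leq_min => -> ->.
Qed.

Section OddColourings.
Variable G : sgraph.

Lemma odd_chromatic_leq k : odd_colourable G k -> odd_chromatic_number G <= k.
Proof. by rewrite /odd_chromatic_number; case: ex_minnP => n _; apply. Qed.

Lemma chromatic_leq k : colourable G k -> chromatic_number G <= k.
Proof. by rewrite /chromatic_number; case: ex_minnP => n _; apply. Qed.

Lemma odd_colourable_of (C : finType) (s : G -> C) :
    (forall u v, adj u v -> s u != s v) ->
    (forall v, exists c, odd #|[set u in nbhd v | s u == c]|) ->
  odd_colourable G #|C|.
Proof.
move=> proper_s odd_s; apply/existsP; exists [ffun v => enum_rank (s v)].
apply/andP; split.
  apply/forallP => u; apply/forallP => v; apply/implyP => uv; rewrite !ffunE.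
  by rewrite (inj_eq enum_rank_inj) proper_s.
apply/forallP => v; apply/implyP => _; have [c oc] := odd_s v.
apply/existsP; exists (enum_rank c).
rewrite (_ : [set u in _ | _] = [set u in nbhd v | s u == c]) //.
by apply/setP => u; rewrite !inE ffunE (inj_eq enum_rank_inj).
Qed.

(** A vertex whose neighbourhood meets S is a neighbour of an element of S. *)
Lemma card_dependency (S : {set G}) D : (forall v : G, degree v <= D) ->
  #|[set u | ~~ [disjoint nbhd u & S]]| <= #|S| * D.
Proof.
move=> degD; rewrite -sum_nat_const.
apply: leq_trans (_ : #|\bigcup_(s in S) nbhd s| <= _).
  apply/subset_leq_card/subsetP => u; rewrite inE.
  move=> /pred0Pn[s /andP[/= us sS]]; apply/bigcupP; exists s => //.
  by move: us; rewrite !inE adj_sym.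
elim/big_rec2: _ => [|s m X _ le]; first by rewrite cards0.
by apply: leq_trans (leq_card_setU _ _) (leq_add (degD s) le).
Qed.

(** The local lemma is applied with b = q^d, the number of assignments of S v,
    and the largest a that satisfies its condition 4 a (d D) <= b; the
    numerical hypothesis, combined with [pairings_sqr], says that a bounds the
    number of bad assignments of S v. *)
Theorem odd_chromatic_bound q d D :
    (forall v : G, d <= degree v <= D) -> 0 < d -> d <= q -> 0 < D ->
    16 * d ^ 2 * D ^ 2 * d`! <= q ^ d ->
  odd_chromatic_number G <= q * chromatic_number G.
Proof.
move=> deg d0 dq D0 num; apply: odd_chromatic_leq; rewrite mulnC.
rewrite /chromatic_number; case: ex_minnP => k /existsP[tau proper_tau] _.
pose S (v : G) : {set G} := [set u in take d (enum (nbhd v))].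
have SN v : S v \subset nbhd v.
  by apply/subsetP => u; rewrite inE => /mem_take; rewrite mem_enum.
have cardS v : #|S v| = d.
  rewrite cardsE (card_uniqP _) ?take_uniq ?enum_uniq //.
  by rewrite size_takel // -cardE; have /andP[] := deg v.
pose col v (c : 'I_q) := (tau v, c).
have col_inj v : injective (col v) by move=> c c' [].
pose bad v := [set g : {ffun G -> 'I_q} | odd_colours col (nbhd v) g == set0].
pose M := q ^ d %/ (4 * (d * D)).
have [g good] : exists g, forall v, g \notin bad v.
  pose dep v := [set u | ~~ [disjoint nbhd u & S v]].
  apply: (@local_lemma _ _ bad dep M (q ^ d) (d * D)).
  - move=> v; rewrite -(cardS v); apply: card_dependency => u.
    by have /andP[] := deg u.
  - by rewrite /M mulnAC [_ * (q ^ d %/ _)]mulnC leq_trunc_div.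
  - have := leq_trunc_div (q ^ d) (4 * (d * D)); rewrite -/M.
    have : 0 < q ^ d by rewrite expn_gt0 (leq_trans d0 dq).
    by have : 0 < d * D; [rewrite muln_gt0 d0|nia].
  - move=> v U UdepS.
    have := @leq_card_fibre G 'I_q (S v) (bad v) (avoiding bad U) M.
    rewrite card_ord cardS; apply.
      move=> f g /fibreP fg; rewrite !inE => /forall_inP fU.
      apply/forall_inP => u uU; apply: contra (fU u uU); rewrite !inE => /eqP <-.
      have uS : [disjoint nbhd u & S v].
        have := disjointFr UdepS uU; rewrite inE => /negbT; by rewrite negbK.
      apply/eqP/setP => c; rewrite !inE; congr (odd _).
      apply: eq_card => w; rewrite !inE; case: (boolP (adj u w)) => //= uw.
      by rewrite fg // (disjointFr uS) // inE.
    move=> f; have [j le] := card_even_fibre col_inj f (SN v).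
    apply: leq_trans le _; rewrite cardS card_ord.
    rewrite leq_divRL ?muln_gt0 ?d0 // -leq_sqr expnMn.
    have := leq_mul (pairings_sqr j dq) (leqnn ((4 * (d * D)) ^ 2)).
    move/leq_trans; apply.
    rewrite -mulnA -[leqRHS]mulnn leq_mul2l; apply/orP; right.
    by apply: leq_trans num; rewrite eq_leq //; ring.
  by rewrite card_ffun card_ord expn_gt0 (leq_trans d0 dq).
have := @odd_colourable_of ('I_k * 'I_q)%type (fun v => col v (g v)).
rewrite card_prod !card_ord; apply.
  move=> u v uv; rewrite xpair_eqE negb_and; apply/orP; left.
  by move/forallP: proper_tau => /(_ u) /forallP /(_ v) /implyP; apply.
move=> v; have := good v; rewrite inE => /set0Pn[c].
by rewrite inE => oc; exists c.
Qed.
End OddColourings.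

(** * Numerical estimates *)

(** Bernoulli's inequality for (1 + y/x)^n, multiplied by x^(n+1). *)
Lemma bernoulli_nat x y n : x ^ n * (x + n * y) <= x * (x + y) ^ n.
Proof.
elim: n => [|n IH]; first by rewrite !expn0 mul0n addn0 mul1n muln1.
rewrite !expnS; move: IH; set a := x ^ n; set b := (x + y) ^ n; move=> IH.
apply: leq_trans (_ : (x + y) * (a * (x + n * y)) <= _); first nia.
by rewrite (mulnCA x) leq_mul2l IH orbT.
Qed.

(** Asymptotically d! is (d/e)^d up to a factor sqrt(d), so the left side is
    exponentially smaller, by (2e/3)^d, than (2d)^d.  The induction uses
    only that ((2d + 1) / (2d - 1))^d >= 2, which makes the right side grow
    faster than the left one from d = 9 on. *)
Lemma factorial_bound d : 9 <= d -> d ^ 2 * 3 ^ d * d`! <= 16 * (2 * d - 1) ^ d.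
Proof.
move/subnKC <-; elim: (d - 9) => [|n]; first by rewrite addn0 !factS fact0; lia.
rewrite addnS; move: (9 + n) (leq_addr n 9) => {}d d9 IH.
have double : 2 * (2 * d - 1) ^ d <= (2 * d.+1 - 1) ^ d.
  have := bernoulli_nat (2 * d - 1) 2 d.
  rewrite (_ : 2 * d - 1 + 2 = 2 * d.+1 - 1); last lia.
  have : 0 < 2 * d - 1 <= 2 * d by lia.
  move: ((2 * d.+1 - 1) ^ d) => b; move: (2 * d - 1) => y /andP[y0 yd].
  move: (y ^ d) => a le; rewrite -(leq_pmul2l y0); nia.
apply: leq_trans (_ : 2 * (2 * d.+1 - 1) * (d ^ 2 * 3 ^ d * d`!) <= _).
  have poly : 3 * d.+1 ^ 3 <= 2 * (2 * d.+1 - 1) * d ^ 2.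
    rewrite (_ : 2 * d.+1 - 1 = 2 * d + 1); last lia.
    by rewrite !expnS !expn0; nia.
  have := leq_mul poly (leqnn (3 ^ d * d`!)); rewrite factS !expnS.
  by apply: etrans; congr (_ <= _); ring.
apply: leq_trans (leq_mul (leqnn _) IH) _; rewrite (expnS (2 * d.+1 - 1)).
move: (leq_mul (leqnn (16 * (2 * d.+1 - 1))) double).
by apply: etrans; congr (_ <= _); ring.
Qed.

Section Eta.
Variable R : realType.
Local Open Scope ring_scope.

(** exp(-1/6) >= 5/6 gives e <= (6/5)^6 < 3. *)
Lemma expR1_le3 : expR 1 <= 3 :> R.
Proof.
have h : expR (- 6%:R^-1) >= 5 / 6 :> R.
  by apply: le_trans (expR_ge1Dx _); lra.
have e : (expR 1 : R) * expR (- 6%:R^-1) ^+ 6 = 1.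
  by rewrite -expRM_natl -expRD (_ : 1 + _ = 0) ?expR0 //; lra.
have p : (5 / 6) ^+ 6 <= expR (- 6%:R^-1 : R) ^+ 6 by rewrite lerXn2r ?nnegrE ?expR_ge0 //; lra.
have := expR_ge0 (1 : R).
move: e p; set y := _ ^+ 6; move=> e p e0.
have : expR 1 * (5/6) ^+ 6 <= expR 1 * y by rewrite ler_wpM2l.
by rewrite e; move: e0; set z := expR 1; lra.
Qed.

Lemma expR1_ge2 : 2 <= expR 1 :> R.
Proof. by apply: le_trans (expR_ge1Dx _); lra. Qed.

Lemma ln49_ge3 (D : nat) : (49 <= D)%N -> 3 <= ln (D%:R : R).
Proof.
move=> D49; rewrite -[leLHS]expRK ler_ln ?posrE ?expR_gt0 ?ltr0n //; last lia.
apply: le_trans (_ : 49%:R <= _); last by rewrite ler_nat.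
rewrite -[3]mulr1 expRM_natl.
apply: le_trans (_ : 3 ^+ 3 <= _); last by lra.
by rewrite lerXn2r ?nnegrE ?expR_ge0 ?expR1_le3.
Qed.

Lemma ln_ln49_ge1 (D : nat) : (49 <= D)%N -> 1 <= ln (ln (D%:R : R)).
Proof.
move=> /ln49_ge3 L3; rewrite -[leLHS]expRK ler_ln ?posrE ?expR_gt0 //; last lra.
exact: le_trans expR1_le3 L3.
Qed.

(** With d = ceil(q/2) one has d >= 2 (ln D + ln ln D + 3) >= 2 ln D + 8, so
    that 3^d >= e^d >= e^8 D^2 >= 2^8 D^2. *)
Lemma eta_lower (D : nat) : (49 <= D)%N ->
  exists q : nat, [/\ eta R D = q%:Z, (14 <= uphalf q)%N &
                     (256 * D ^ 2 <= 3 ^ uphalf q)%N].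
Proof.
move=> D49; have L3 := ln49_ge3 D49; have l1 := ln_ln49_ge1 D49.
set L := ln _ in L3 l1; set l := ln L in l1.
have etale : 4 * (L + l + 3) <= (eta R D)%:~R by apply: Num.Theory.ceil_ge.
have eta0 : 0 <= eta R D by rewrite -(ler0z R); lra.
case E : (eta R D) etale eta0 => [q|//] etale _; exists q.
rewrite -[_%:~R]/(q%:R) in etale.
have half : q%:R <= 2 * (uphalf q)%:R :> R.
  by rewrite -natrM ler_nat; lia.
split => //.
  by rewrite -(ler_nat R); lra.
rewrite -(ler_nat R) natrM !natrX.
apply: le_trans (_ : expR 1 ^+ uphalf q <= _); last first.
  by rewrite lerXn2r ?nnegrE ?expR_ge0 ?expR1_le3.
rewrite -expRM_natl mulr1.
apply: le_trans (_ : expR (8 * 1 + 2 * L) <= _); last by rewrite ler_expR; lra.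
rewrite expRD !expRM_natl lnK ?posrE ?ltr0n //; last lia.
rewrite ler_wpM2r ?exprn_ge0 //.
apply: le_trans (_ : 2 ^+ 8 <= _); first by lra.
by rewrite lerXn2r ?nnegrE ?expR_ge0 ?expR1_ge2.
Qed.

(** The bound ln ln D <= ln D suffices here: eta - 1 is at most 8 ln D + 12,
    that is 8 (9 r + 1) + 12. *)
Lemma eta_upper (D r : nat) : (49 <= D)%N -> (0 < r)%N ->
  (D <= 2 ^ (9 * r + 1))%N -> eta R D <= (128 * r)%:Z.
Proof.
move=> D49 r0 Dle; have L3 := ln49_ge3 D49.
have L9 : ln (D%:R : R) <= 9 * r%:R + 1.
  rewrite -[leRHS]expRK ler_ln ?posrE ?expR_gt0 ?ltr0n //; last lia.
  rewrite (_ : _ + 1 = (9 * r + 1)%:R * 1); last by rewrite mulr1 natrD natrM.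
  rewrite expRM_natl; apply: le_trans (_ : (2 ^ (9 * r + 1))%:R <= _).
    by rewrite ler_nat.
  by rewrite natrX lerXn2r ?nnegrE ?expR_ge0 ?expR1_ge2.
have lL : ln (ln (D%:R : R)) < ln (D%:R : R) by apply: ln_sublinear; lra.
rewrite /eta ceil_le_int -[_%:~R]/((128 * r)%:R) natrM.
have : 1 <= r%:R :> R by rewrite ler1n.
lra.
Qed.
End Eta.

(** * A family for which the bound is tight *)

(** A takes one element from each fibre of g of odd size; its elements then
    have distinct images. *)
Lemma even_off_transversal (T C : finType) (g : T -> C) :
  exists2 A : {set T}, #|A| <= #|[set g x | x : T]| &
    forall c, ~~ odd #|[set x | (x \notin A) && (g x == c)]|.
Proof.
(* [pick] depends on g x only, so it selects one representative per fibre. *)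
pose A := [set x | odd #|[set y | g y == g x]|
                   && ([pick y | g y == g x] == Some x)].
have A_inj : {in A &, injective g}.
  move=> x y; rewrite !inE => /andP[_ /eqP ex] /andP[_ /eqP ey] gxy.
  by apply: Some_inj; rewrite -ex -ey gxy.
exists A => [|c].
  by rewrite -(card_in_imset A_inj); apply/subset_leq_card/imsetS/subsetP.
have [odd_c|even_c] := boolP (odd #|[set y | g y == c]|).
  (* An odd class loses exactly its representative y. *)
  case ec : [pick y | g y == c] => [y|]; last first.
    move: odd_c; rewrite (_ : [set _ | _] = set0) ?cards0 //.
    by apply/setP => y; rewrite !inE; move: ec; case: pickP => // ->.
  have gy : g y = c by move: ec; case: pickP => // z /eqP <- [->].
  have -> : [set x | (x \notin A) && (g x == c)] = [set x | g x == c] :\ y.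
    apply/setP => x; rewrite !inE; case: (g x =P c) => [->|]; last by rewrite !andbF.
    by rewrite odd_c ec (inj_eq Some_inj) eq_sym andbT.
  by move: odd_c; rewrite (cardsD1 y) inE gy eqxx /=.
have -> // : [set x | (x \notin A) && (g x == c)] = [set x | g x == c].
apply/setP => x; rewrite !inE; case: (g x =P c) => [->|]; last by rewrite andbF.
by rewrite (negbTE even_c).
Qed.

(** Give each set A the weight a^(m - #|A|): the weights add up to (a + 1)^m by
    the binomial theorem, and the sets with at most r elements have weight at
    least a^(m - r). *)
Lemma card_small_sets (m r a : nat) : 0 < a ->
  #|{: {A : {set 'I_m} | #|A| <= r}}| * a ^ (m - r) <= (a + 1) ^ m.
Proof.
move=> a0; rewrite card_sig -sum_nat_const expnDn.
apply: leq_trans (_ : \sum_(A : {set 'I_m}) a ^ (m - #|A|) <= _).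
  rewrite [leqRHS](bigID (fun A : {set 'I_m} => #|A| <= r)) /=.
  apply: leq_trans (leq_addr _ _); apply: leq_sum => A Ar.
  by rewrite leq_pexp2l // leq_sub2l.
rewrite (partition_big (fun A : {set 'I_m} => inord #|A| : 'I_m.+1) predT) //=.
apply: leq_sum => j _; rewrite exp1n muln1.
have -> : \sum_(A : {set 'I_m} | inord #|A| == j) a ^ (m - #|A|)
          = \sum_(A in [set A : {set 'I_m} | #|A| == j]) a ^ (m - j).
  have eqj (A : {set 'I_m}) : (inord #|A| == j) = (#|A| == j).
    by rewrite -val_eqE /= inordK // ltnS -[leqRHS]card_ord max_card.
  by apply: eq_big => [A|A]; rewrite eqj ?inE // => /eqP ->.
by rewrite sum_nat_const card_draws card_ord.
Qed.

Lemma card_small_sets_exp (r p a c : nat) :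
    0 < a -> (a + 1) ^ p.+1 <= c * a ^ p ->
  #|{: {A : {set 'I_(p.+1 * r)} | #|A| <= r}}| <= c ^ r.
Proof.
move=> a0 ac; have := @card_small_sets (p.+1 * r) r a a0.
rewrite mulSn addKn -mulSn !expnM => count.
rewrite -(@leq_pmul2r ((a ^ p) ^ r)) ?expn_gt0 ?a0 //.
apply: leq_trans count _; rewrite -expnMn.
by case: r => // r; rewrite leq_exp2r.
Qed.

Section SubsetGraph.
Variables t m r : nat.

(** The left summand holds the t parts, which are copies of 'I_m; the vertex
    (i, A) of the right summand sees the complement of A in the part i. *)
Definition subset_vertex :=
  (('I_t * 'I_m) + ('I_t * {A : {set 'I_m} | #|A| <= r}))%type.

Definition subset_adj (u v : subset_vertex) : bool :=
  match u, v with
  | inl a, inl b => a.1 != b.1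
  | inl a, inr b | inr b, inl a => (a.1 == b.1) && (a.2 \notin val b.2)
  | inr _, inr _ => false
  end.

Lemma subset_adj_sym : symmetric subset_adj.
Proof. by move=> [a|a] [b|b] //=; rewrite eq_sym. Qed.

Lemma subset_adj_irr : irreflexive subset_adj.
Proof. by move=> [a|a] //=; rewrite eqxx. Qed.

Definition subset_graph : sgraph := SGraph subset_adj_sym subset_adj_irr.

Lemma degree_inl_lower (a : 'I_t * 'I_m) :
  1 < t -> m <= degree (inl a : subset_graph).
Proof.
case: a => i x t1.
have [j ji] : exists j : 'I_t, i != j.
  have /card_gt0P[j] : 0 < #|[set~ i]| by rewrite cardsC1 card_ord; case: t t1 => [|[]].
  by rewrite !inE eq_sym; exists j.
rewrite -[leqLHS]card_ord.
have inj : injective (fun y : 'I_m => inl (j, y) : subset_graph) by move=> y z [].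
rewrite -(card_imset _ inj); apply/subset_leq_card/subsetP => _ /imsetP[y _ ->].
by rewrite inE.
Qed.

Lemma nbhd_inr (b : 'I_t * {A : {set 'I_m} | #|A| <= r}) :
  nbhd (inr b : subset_graph)
    = [set (inl (b.1, x) : subset_graph) | x in ~: val b.2].
Proof.
apply/setP => -[[i x]|c]; rewrite inE /=; last first.
  by apply/esym/negbTE/imsetP => -[].
apply/andP/imsetP => [[/eqP /= -> xb]|[y yb [-> ->]]].
  by exists x; rewrite // inE.
by rewrite eqxx -in_setC.
Qed.

Lemma degree_inr (b : 'I_t * {A : {set 'I_m} | #|A| <= r}) :
  degree (inr b : subset_graph) = m - #|val b.2|.
Proof.
rewrite /degree nbhd_inr card_imset; last by move=> x y [].
move: (val b.2) => A; apply/eqP; rewrite -(eqn_add2l #|A|) cardsC card_ord subnKC //.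
by rewrite -[leqRHS]card_ord max_card.
Qed.

Lemma degree_upper (v : subset_graph) :
  degree v <= t * m + #|{: {A : {set 'I_m} | #|A| <= r}}|.
Proof.
case: v => [[i x]|b]; last first.
  rewrite degree_inr; apply: leq_trans (leq_subr _ _) _.
  apply: leq_trans (leq_addr _ _); case: t b => [|t'] b; first by case: b => -[].
  by rewrite leq_pmull.
pose H := {A : {set 'I_m} | #|A| <= r}.
apply: leq_trans (_ : #|[set (inl a : subset_graph) | a in [set: 'I_t * 'I_m]]
   :|: [set (inr (i, A) : subset_graph) | A in [set: H]]| <= _).
  apply/subset_leq_card/subsetP => -[a|[j A]]; rewrite !inE /=.
    by move=> _; apply/orP; left; apply/imsetP; exists a; rewrite ?inE.
  by move=> /andP[/eqP <- _]; apply/orP; right; apply/imsetP; exists A; rewrite ?inE.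
apply: leq_trans (leq_card_setU _ _) _.
apply: leq_add; apply: leq_trans (leq_imset_card _ _) _; rewrite cardsT //.
by rewrite card_prod !card_ord.
Qed.

Lemma subset_chromatic : 1 < t -> 0 < m -> chromatic_number subset_graph = t.
Proof.
move=> t1 m0; apply/eqP; rewrite eqn_leq; apply/andP; split.
  apply: chromatic_leq; apply/existsP.
  pose i0 := Ordinal (ltnW t1); pose i1 := Ordinal t1.
  exists [ffun v : subset_graph => match v with
    | inl a => a.1 | inr b => if b.1 == i0 then i1 else i0 end].
  have other (i : 'I_t) : i != (if i == i0 then i1 else i0).
    by case: (altP (i =P i0)) => [->|].
  apply/forallP => -[a|a]; apply/forallP => -[b|b]; apply/implyP; rewrite !ffunE //=.
    by move=> /andP[/eqP -> _].
  by move=> /andP[/eqP -> _]; rewrite eq_sym.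
rewrite /chromatic_number; case: ex_minnP => k /existsP[s proper_s] _.
pose x0 := Ordinal m0.
have inj : injective (fun i : 'I_t => s (inl (i, x0))).
  move=> i j /eqP sij; apply/eqP; apply: contraTT sij => ij.
  by move/forallP: proper_s => /(_ (inl (i, x0))) /forallP /(_ (inl (j, x0))) /implyP; apply.
by have := leq_card _ inj; rewrite !card_ord.
Qed.

(** If the palette of a part i had at most r colours, [even_off_transversal]
    would give a set A for which the vertex (i, A) sees no colour an odd number
    of times; and distinct parts have disjoint palettes, being completely
    joined. *)
Lemma subset_odd_chromatic : r < m -> t * r <= odd_chromatic_number subset_graph.
Proof.
move=> rm; rewrite /odd_chromatic_number; case: ex_minnP => k /existsP[s] /andP[].
move=> proper_s odd_s _.
pose palette i := [set s (inl (i, x)) | x : 'I_m].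
have big i : r < #|palette i|.
  rewrite ltnNge; apply/negP => small.
  have [A leA evenA] := even_off_transversal (fun x => s (inl (i, x))).
  have Ar : #|A| <= r by apply: leq_trans leA small.
  pose v : subset_graph := inr (i, exist _ A Ar).
  have : nbhd v != set0.
    by rewrite -card_gt0 -/(degree v) degree_inr subn_gt0 (leq_ltn_trans Ar).
  move/(implyP (forallP odd_s v)) => /existsP[c].
  apply/negP; have := evenA c; congr (~~ odd _).
  rewrite nbhd_inr -(card_imset _ (f := fun x => inl (i, x) : subset_graph)) => [|x y [] //].
  apply: eq_card => u; rewrite !inE; apply/imsetP/andP.
    move=> [x]; rewrite inE => /andP[xA sx] ->; split => //.
    by apply/imsetP; exists x; rewrite ?inE.
  by move=> [/imsetP[x + ->]]; rewrite inE => xA sx; exists x; rewrite ?inE ?xA.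
have disj i j : i != j -> [disjoint palette i & palette j].
  move=> ij; apply/pred0Pn => -[c /andP[/= /imsetP[x _ ->] /imsetP[y _]]].
  apply/eqP; move/forallP: proper_s => /(_ (inl (i, x))) /forallP /(_ (inl (j, y))).
  by move/implyP; apply.
have := partition_disjoint_bigcup addn (fun=> 1) disj.
rewrite sum1_card => card_cup.
rewrite -[k]card_ord; apply: leq_trans (max_card (\bigcup_i palette i)).
rewrite card_cup -[t in t * r]card_ord -sum_nat_const.
by apply: leq_sum => i _; rewrite sum1_card; apply/ltnW/big.
Qed.

End SubsetGraph.

(** [card_small_sets_exp] with weight a = 128, the ratio between the size of
    a part and r, counts the sets A: 129^128 / 128^127 = 128 (1 + 1/128)^128 is
    smaller than 128 e, hence than 2^9. *)
Lemma tight_max_degree r : 0 < r ->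
  max_degree (subset_graph r (128 * r) r) <= 2 ^ (9 * r + 1).
Proof.
move=> r0; apply/bigmax_leqP => v _; apply: leq_trans (degree_upper v) _.
rewrite addn1 expnS mul2n -addnn; apply: leq_add.
  have r2 : r <= 2 ^ r by apply/ltnW/ltn_expl.
  apply: leq_trans (_ : 2 ^ r * (128 * 2 ^ r) <= _); first by rewrite !leq_mul.
  rewrite -[128]/(2 ^ 7) -!expnD leq_exp2l //; lia.
have base : (128 + 1) ^ 127.+1 <= 2 ^ 9 * 128 ^ 127 by lia.
by rewrite expnM; exact: (@card_small_sets_exp r 127 128 _ isT base).
Qed.

Theorem tight_family (R : realType) (n : nat) :
  let r := n.+2 in let G := subset_graph r (128 * r) r in
  [/\ chromatic_number G = r, (r * r <= odd_chromatic_number G)%N,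
      (49 <= max_degree G)%N, (64 * r <= min_degree G)%N &
      (eta R (max_degree G) <= (128 * r)%:Z)%R].
Proof.
move=> r G; have chi : chromatic_number G = r by apply: subset_chromatic.
have v : 'I_r * 'I_(128 * r) by split; exists 0.
have big : 49 <= max_degree G.
  apply: leq_trans (leq_bigmax (inl v : G)).
  by apply: leq_trans (degree_inl_lower _ v isT); rewrite /r; lia.
split => //.
- by apply: subset_odd_chromatic; rewrite /r; lia.
- apply: leq_min_degree => [|[a|[i [A Ar]]]].
  + rewrite card_sum card_prod !card_ord; apply: leq_trans (leq_addr _ _); rewrite /r; nia.
  + by apply: leq_trans (degree_inl_lower _ a isT); rewrite /r; lia.
  + by rewrite degree_inr; have : #|A| <= r := Ar; rewrite /=; move: #|A|; lia.
- by apply: eta_upper => //; apply: tight_max_degree.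
Qed.

Local Open Scope ring_scope.

Theorem corollary5p6 (R : realType) :
  (forall (D : nat) (G : sgraph),
     (49 <= D)%N ->
     max_degree G = D ->
     (eta R D)%:~R / 2 <= (min_degree G)%:R :> R ->
     (odd_chromatic_number G)%:Z <= eta R D * (chromatic_number G)%:Z) /\
  (exists (c : R) (F : nat -> sgraph),
     [/\ 0 < c,
         forall k : nat, exists n : nat, (k <= chromatic_number (F n))%N &
         forall n : nat,
           [/\ (49 <= max_degree (F n))%N,
               (eta R (max_degree (F n)))%:~R / 2
                 <= (min_degree (F n))%:R :> R &
               c * (eta R (max_degree (F n)))%:~R
                   * (chromatic_number (F n))%:R
                 <= (odd_chromatic_number (F n))%:R :> R]]).
Proof.
split=> [D G D49 maxG|].
  have [q [-> d14 Dd]] := eta_lower R D49; rewrite -[_%:~R]/(q%:R) => minG.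
  have dmin : (uphalf q <= min_degree G)%N.
    have : q%:R <= (2 * min_degree G)%:R :> R by rewrite natrM; lra.
    by rewrite ler_nat; lia.
  rewrite -PoszM lez_nat.
  apply: (@odd_chromatic_bound G q (uphalf q) D) => [v||||]; try lia.
    by rewrite (leq_trans dmin (min_degree_leq v)) -maxG leq_bigmax.
  have d9 : (9 <= uphalf q)%N by lia.
  have := factorial_bound d9; have : (2 * uphalf q - 1 <= q)%N by lia.
  rewrite -(@leq_exp2r _ _ (uphalf q)); last lia.
  move: (uphalf q) Dd => d Dd bq fact.
  (* Multiplying by 256 lets 256 D^2 <= 3^d replace D^2 in the left side. *)
  rewrite -(@leq_pmul2l 256) //; apply: leq_trans (_ : 16 * (d ^ 2 * 3 ^ d * d`!) <= _)%N.
    by have := leq_mul (leqnn (16 * d ^ 2 * d`!)%N) Dd;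
       apply: etrans; congr (_ <= _)%N; ring.
  apply: leq_trans (leq_mul (leqnn 16) fact) _.
  by rewrite mulnA leq_mul.
(* Two parts are needed to give a colour to the added vertices, whence n + 2. *)
exists (128%:R^-1), (fun n => subset_graph n.+2 (128 * n.+2) n.+2).
split=> [|k|n]; first by rewrite invr_gt0 ltr0n.
  by exists k; have [-> _ _ _ _] := tight_family R k; lia.
have [-> odd_chi big mind] := tight_family R n.
rewrite -(ler_int R) -[(_ * _)%N%:~R]/((128 * n.+2)%:R) natrM => e_le.
split; first exact: big.
  have : (64 * n.+2)%:R <= (min_degree (subset_graph n.+2 (128 * n.+2) n.+2))%:R :> R.
    by rewrite ler_nat.
  by rewrite natrM; lra.
apply: le_trans (_ : (n.+2 * n.+2)%:R <= _); last by rewrite ler_nat.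
by rewrite natrM ler_wpM2r //; lra.
Qed.
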